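(* The PCF curve $V(2)_{2,1}$ has exactly four $\mathbb{Z}$-points: $$(y_1,y_2,x_1)=(1,0,-2),\ (-1,-2,-2),\ (1,2,2),\ (-1,0,2).$$ Hence, $\sqrt2$ has exactly two $\mathbb{Z}$-PCFs of type $(2,1)$: $$\sqrt2=[-1,0,\overline{2}]\quad\text{and}\quad\sqrt2=[1,2,\overline{2}].$$
   Context: Put $D(c)=\begin{bmatrix}c&1\\1&0\end{bmatrix}$ and $\begin{bmatrix}E_{11}&E_{12}\\ E_{21}&E_{22}\end{bmatrix}=D(y_1)D(y_2)\,D(x_1)\,\bigl(D(y_1)D(y_2)\bigr)^{-1}$, with entries in $\mathbb{Z}[y_1,y_2,x_1]$. The PCF variety $V(2)_{2,1}\subseteq\mathbb{A}^2\times\mathbb{A}^1$ (coordinates $(y_1,y_2,x_1)$), associated with the polynomial $x^2-2$, is defined by $A(E_{22}-E_{11})=BE_{21}$, $-AE_{12}=CE_{21}$, $-BE_{12}=C(E_{22}-E_{11})$ for $(A,B,C)=(1,0,-2)$; explicitly, $$2y_1y_2^2-2y_1y_2x_1-2y_1+2y_2-x_1=0,$$ $$-y_1^2y_2^2+y_1^2y_2x_1+y_1^2-2y_1y_2+y_1x_1-1=-2(y_2x_1-y_2^2+1).$$ A $\mathbb{Z}$-PCF of type $(2,1)$ of $\sqrt2$ is a periodic continued fraction $[b_1,b_2,\overline{a_1}]$, with $b_1,b_2,a_1\in\mathbb{Z}$, whose value is $\sqrt2$. Here the partial quotients $c_1,c_2,\ldots$ are $b_1,b_2,a_1,a_1,\ldots$;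 the $n$-th convergent is $M_{11}/M_{21}\in\mathbb{P}^1(\mathbb{C})$ with $M=D(c_1)\cdots D(c_n)$, and the value is the limit of the convergents in $\mathbb{P}^1(\mathbb{C})$, if it exists. *)

(* Defs.v *)
From mathcomp Require Import all_boot all_order all_algebra.
From mathcomp Require Import all_classical all_reals all_analysis.
From mathcomp Require Export complex.

Set Implicit Arguments.
Unset Strict Implicit.
Unset Printing Implicit Defensive.

Import GRing.Theory Num.Theory.
Import numFieldNormedType.Exports.

Local Open Scope classical_set_scope.
Local Open Scope complex_scope.
Local Open Scope ring_scope.

Section PCFVariety.
Variable S : comUnitRingType.

Definition Dmx (c : S) : 'M[S]_2 :=
  \matrix_(i < 2, j < 2) nth 0 (nth [::] [:: [:: c; 1]; [:: 1; 0]] i) j.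

Definition Dprod (s : seq S) : 'M[S]_2 := \prod_(c <- s) Dmx c.

(* [Dprod y] has determinant [(-1) ^+ size y], so the inverse is a genuine
   one over every [S]. *)
Definition Emx (y x : seq S) : 'M[S]_2 := Dprod y * Dprod x * (Dprod y)^-1.

(* The [S]-points of the PCF variety [V_(N,k)] attached to the quadratic
   polynomial [A x^2 + B x + C]. Matrix indices start from 0, so that
   [E 0 0], [E 0 1], [E 1 0], [E 1 1] are E_11, E_12, E_21, E_22. *)
Definition pcf_variety (A B C : int) (N k : nat)
    (y : N.-tuple S) (x : k.-tuple S) : Prop :=
  let E := Emx y x in
  [/\ A%:~R * (E 1 1 - E 0 0) = B%:~R * E 1 0,
      - (A%:~R * E 0 1) = C%:~R * E 1 0
    & - (B%:~R * E 0 1) = C%:~R * (E 1 1 - E 0 0)].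

End PCFVariety.

Section PCFValue.
Variable R : realType.

(* P^1(C) is the Riemann sphere: [Some z] is [z : 1] and [None] is [1 : 0].
   The regular module [R[i]^o] carries the usual topology of C. *)
Definition P1C := one_point_compactification (R[i]^o).

Definition P1C_ratio (p q : R[i]) : P1C :=
  if q == 0 then None else Some (p / q).

(* The partial quotients [c_1, c_2, ...] are [c 0, c 1, ...]. The term of
   index 0, the empty product, is [1 : 0] and does not affect the limit. *)
Definition convergent (c : nat -> R[i]) (n : nat) : P1C :=
  let M := Dprod [seq c i | i <- iota 0 n] in P1C_ratio (M 0 0) (M 1 0).

(* For a sequence of integers b_1, ..., b_N followed by the period
   a_1, ..., a_k. *)
Definition pcf_quotient (N k : nat) (b : N.-tuple int) (a : k.-tuple int)
    (n : nat) : R[i] :=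
  (if (n < N)%N then nth 0 b n else nth 0 a ((n - N) %% k))%:~R.

Definition pcf_has_value (N k : nat) (b : N.-tuple int) (a : k.-tuple int)
    (v : P1C) : Prop :=
  convergent (pcf_quotient b a) @ \oo --> v.

Definition is_ZPCF_of (z : R[i]) (N k : nat)
    (b : N.-tuple int) (a : k.-tuple int) : Prop :=
  pcf_has_value b a (Some z).

End PCFValue.

(* Main.v *)
(* Writing (a, b, x) for (y1, y2, x1), the first equation of the curve reads
   (x - b) (2ab + 1) = b - 2a. Unless a = 0, b = 0 or b = 2a, comparing sizes
   leaves finitely many cases, and the second equation decides all of them.
   The matrix M_n of the n-th convergent satisfies M_(n+1) = E M_n for n >= 2,
   so a limit sqrt 2 is fixed by the Moebius map of E, and the irrationality
   of sqrt 2 forces the equations of the curve. At the four integer points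
   E = [[t, 2], [1, t]] with t = x / 2 = 1 or -1. If t = -1, the convergents
   p / q keep p q <= 0, so they stay away from sqrt 2; if t = 1, then
   |p ^ 2 - 2 q ^ 2| = 1 while q tends to infinity, so p / q tends to
   sqrt 2. *)
Require Import Defs.
From mathcomp Require Import all_boot all_order all_algebra.
From mathcomp Require Import all_classical all_reals all_analysis.
From mathcomp Require Import zify ring lra.

Set Implicit Arguments.
Unset Strict Implicit.
Unset Printing Implicit Defensive.

Import Order.TTheory GRing.Theory Num.Theory.
Import numFieldNormedType.Exports.

Local Open Scope classical_set_scope.
Local Open Scope complex_scope.
Local Open Scope ring_scope.

(** * Two-by-two matrices and the entries of [Emx] *)

Section TwoByTwo.
Variable S : comUnitRingType.
Implicit Types A B : 'M[S]_2.

Lemma ord2P (i : 'I_2) : i = 0 \/ i = 1.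
Proof. by case: i => [[|[|//]] ?]; [left | right]; apply/val_inj. Qed.

Lemma mul2E A B i j : (A * B) i j = A i 0 * B 0 j + A i 1 * B 1 j.
Proof.
rewrite mxE big_ord_recl big_ord1.
by rewrite (_ : lift ord0 ord0 = 1) //; apply/val_inj.
Qed.

Lemma eq2P A B :
  [/\ A 0 0 = B 0 0, A 0 1 = B 0 1, A 1 0 = B 1 0 & A 1 1 = B 1 1] -> A = B.
Proof.
by case=> ? ? ? ?; apply/matrixP=> i j; case: (ord2P i) (ord2P j) => -> [] ->.
Qed.

Lemma DmxE (c : S) :
  [/\ Dmx c 0 0 = c, Dmx c 0 1 = 1, Dmx c 1 0 = 1 & Dmx c 1 1 = 0].
Proof. by rewrite !mxE. Qed.

Lemma Dmx_unit (c : S) : Dmx c \is a GRing.unit.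
Proof.
pose V : 'M[S]_2 := \matrix_(i, j)
  (if i == 0 then if j == 0 then 0 else 1 else if j == 0 then 1 else - c).
suff DV : Dmx c *m V = 1%:M by have [] := mulmx1_unit DV.
have [d00 d01 d10 d11] := DmxE c.
by apply: eq2P; split; rewrite mul2E ?d00 ?d01 ?d10 ?d11 !mxE //=; ring.
Qed.

Lemma Dprod_unit (s : seq S) : Dprod s \is a GRing.unit.
Proof. by rewrite rpred_prod // => c _; exact: Dmx_unit. Qed.

Lemma Dprod2E (b1 b2 : S) : let P := Dprod [:: b1; b2] in
  [/\ P 0 0 = b1 * b2 + 1, P 0 1 = b1, P 1 0 = b2 & P 1 1 = 1].
Proof.
rewrite /Dprod 2!big_cons big_nil mulr1.
have [e00 e01 e10 e11] := DmxE b1; have [d00 d01 d10 d11] := DmxE b2.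
by split; rewrite mul2E ?d00 ?d01 ?d10 ?d11 ?e00 ?e01 ?e10 ?e11; ring.
Qed.

(** The conjugation with the inverse cleared, so that no inverse has to be computed. *)
Lemma Emx_Dprod (y : seq S) (a : S) :
  Emx y [:: a] * Dprod y = Dprod y * Dmx a.
Proof.
by rewrite /Emx {2}/Dprod big_seq1 mulrVK ?Dprod_unit.
Qed.

Lemma Emx21E (b1 b2 a : S) : let E := Emx [:: b1; b2] [:: a] in
  [/\ E 0 0 = (b1 * b2 + 1) * a + b1 - b2 * (b1 * b2 + 1),
      E 0 1 = (b1 * b2 + 1) ^+ 2 - b1 * ((b1 * b2 + 1) * a + b1),
      E 1 0 = b2 * a + 1 - b2 ^+ 2
    & E 1 1 = b2 * (b1 * b2 + 1) - b1 * (b2 * a + 1)].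
Proof.
move=> E; have := Emx_Dprod [:: b1; b2] a.
rewrite -/E => /matrixP; move: E => E EP; have [p00 p01 p10 p11] := Dprod2E b1 b2.
have [d00 d01 d10 d11] := DmxE a.
pose P := Dprod [:: b1; b2].
(* Row [i] of the identity is a linear system of determinant [(b1 * b2 + 1) - b1 * b2 = 1], solved
   by Cramer's rule without division. *)
have {}EP i : E i 0 = P i 0 * a + P i 1 - b2 * P i 0 /\
    E i 1 = (b1 * b2 + 1) * P i 0 - b1 * (P i 0 * a + P i 1).
  have := EP i 1; have := EP i 0.
  rewrite 2!(mul2E E) 2!(mul2E (Dprod _)) p00 p01 p10 p11 d00 d01 d10 d11.
  move=> EP0 EP1.
  rewrite /P; move: (Dprod _ i 0) (Dprod _ i 1) EP0 EP1 => u v EP0 EP1.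
  split.
    by transitivity (u * a + v * 1 - b2 * (u * 1 + v * 0));
      [rewrite -EP0 -EP1|]; ring.
  by transitivity ((b1 * b2 + 1) * (u * 1 + v * 0) - b1 * (u * a + v * 1));
    [rewrite -EP0 -EP1|]; ring.
have [] := EP 0; have [] := EP 1; rewrite /P p00 p01 p10 p11 => -> -> -> ->.
by split; ring.
Qed.

End TwoByTwo.

(** * The matrices of the convergents *)

(* [tail_mx b1 b2 a n] is the matrix of the convergent of index [n + 2]. *)
Definition tail_mx (b1 b2 a : int) (n : nat) : 'M[int]_2 :=
  Dprod [:: b1; b2] * Dmx a ^+ n.

Lemma tail_mxS b1 b2 a n :
  tail_mx b1 b2 a n.+1 = Emx [:: b1; b2] [:: a] * tail_mx b1 b2 a n.
Proof. by rewrite /tail_mx mulrA Emx_Dprod exprS mulrA. Qed.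

Lemma map_Dmx (S : comUnitRingType) (c : int) :
  map_mx intr (Dmx c) = Dmx (c%:~R : S).
Proof.
have [e00 e01 e10 e11] := DmxE c; have [d00 d01 d10 d11] := DmxE (c%:~R : S).
apply: eq2P; split; rewrite mxE ?d00 ?d01 ?d10 ?d11 ?e00 ?e01 ?e10 ?e11 //.
Qed.

Lemma Dprod_pcf_quotient (R : realType) (b1 b2 a : int) n :
  let c := @pcf_quotient R 2 1 [tuple b1; b2] [tuple a] in
  Dprod [seq c i | i <- iota 0 n.+2] = map_mx intr (tail_mx b1 b2 a n).
Proof.
move=> c; elim: n => [|n IHn].
  rewrite /tail_mx expr0 mulr1 /Dprod !big_cons !big_nil !mulr1.
  by rewrite map_mxM !map_Dmx.
rewrite -[n.+3]addn1 iotaD map_cat /Dprod big_cat big_seq1 /=.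
rewrite [X in X * _]IHn add0n /tail_mx exprSr mulrA.
rewrite map_mxM [RHS]map_mxM map_Dmx.
by rewrite -map_mxM /c /pcf_quotient /= modn1.
Qed.

(** * Convergence on the Riemann sphere as a real estimate *)

Section Value.
Variables (R : realType) (b1 b2 a : int).
Let num n : R := (tail_mx b1 b2 a n 0 0)%:~R.
Let den n : R := (tail_mx b1 b2 a n 1 0)%:~R.

(** Finite convergents are real, so convergence can be tested in [R]. The condition [den n != 0]
    excludes the point at infinity, which the default value of division by 0 would hide. *)
Lemma is_ZPCF_ofP (x : R) :
  is_ZPCF_of x%:C [tuple b1; b2] [tuple a] <->
  (forall e : R, 0 < e ->
     \forall n \near \oo, den n != 0 /\ `|x - num n / den n| < e).
Proof.
set c := @pcf_quotient R 2 1 [tuple b1; b2] [tuple a].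
have convE n : convergent c n.+2 =
    if den n == 0 then None else Some ((num n / den n)%:C).
  rewrite /convergent /P1C_ratio Dprod_pcf_quotient.
  rewrite [map_mx _ _ 0 0]mxE [map_mx _ _ 1 0]mxE.
  rewrite -[(tail_mx _ _ _ _ 1 0)%:~R](rmorph_int (real_complex R)).
  rewrite -[(tail_mx _ _ _ _ 0 0)%:~R](rmorph_int (real_complex R)).
  by rewrite fmorph_eq0 -fmorph_div.
have normE (u v : R) : `|u%:C - v%:C| = `|u - v|%:C.
  by rewrite -rmorphB normc_def /= expr0n /= addr0 sqrtr_sqr.
split=> [cv e e0 | cv U].
  have /cv [N _ HN] : nbhs (Some x%:C : P1C R) (Some @` ball (x%:C : R[i]^o) e%:C).
    apply: one_point_compactification_some_nbhs; apply: nbhsx_ballx.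
    by rewrite ltcR.
  exists N => // n /= Nn.
  have /HN : (N <= n.+2)%N by apply: leq_trans Nn _; rewrite -addn2 leq_addr.
  rewrite /= convE; case: eqP => [_ [//]|_ [z + [zE]]].
  by rewrite -ball_normE /= zE normE ltcR.
move=> [/= e e0] eU.
(* Positivity in [R[i]] forces a zero imaginary part. *)
have [e' e'0 eE] : exists2 e' : R, 0 < e' & e = e'%:C.
  move: e0; case: (e) => er ei; rewrite ltcE /= => /andP[/eqP -> er0].
  by exists er.
have [N _ HN] := cv _ e'0.
exists N.+2 => // -[|[|n]] //= Nn.
have [dn0 dn] := HN n Nn.
rewrite convE (negPf dn0); apply: eU.
by rewrite /= normE eE ltcR.
Qed.

End Value.

(** * From the value sqrt 2 to the equations of the curve *)

(** For [q != 0], the exponent of 2 would be even on the left and odd on the right. *)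
Lemma sqr_eq_double (p q : int) : p ^+ 2 = 2 * q ^+ 2 -> q = 0.
Proof.
move=> /(congr1 absz); rewrite abszM !abszX => pq.
apply/eqP; rewrite -absz_eq0; apply: contraT; rewrite -lt0n => q0.
have := congr1 (logn 2) pq.
rewrite lognM ?expn_gt0 ?q0 // !lognX (logn_prime _ (isT : prime 2)) /=; lia.
Qed.

Lemma sqrt2_lin_eq0 (R : realType) (p q : int) :
  p%:~R * Num.sqrt 2 = q%:~R :> R -> p = 0 /\ q = 0.
Proof.
move=> e.
have : q ^+ 2 = 2 * p ^+ 2.
  apply/(@intr_inj R); rewrite [RHS]rmorphM !rmorphXn /= -e exprMn sqr_sqrtr //.
  by rewrite mulrC.
move=> pq; have p0 := sqr_eq_double pq; split=> //.
by apply/(@intr_inj R); rewrite -e p0 mul0r.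
Qed.

Lemma ZPCF_sqrt2_variety (R : realType) (b1 b2 a : int) :
  is_ZPCF_of (Num.sqrt (2 : R))%:C [tuple b1; b2] [tuple a] ->
  pcf_variety 1 0 (-2) [tuple b1; b2] [tuple a].
Proof.
move=> /is_ZPCF_ofP cv; set x : R := Num.sqrt 2 in cv.
pose r n : R := (tail_mx b1 b2 a n 0 0)%:~R / (tail_mx b1 b2 a n 1 0)%:~R.
pose E := Emx [:: b1; b2] [:: a].
have rx : r n @[n --> \oo] --> x.
  by apply/cvgrPdist_lt => e /cv; apply: filterS => n [].
have rSx : r n.+1 @[n --> \oo] --> x by rewrite (cvg_shiftS r).
have d0 : \forall n \near \oo, (tail_mx b1 b2 a n 1 0)%:~R != 0 :> R.
  by apply: filterS (cv 1 ltr01) => n [].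
(* The Moebius map of [E] with its denominator cleared: the limit can be taken without knowing that
   the denominator stays away from 0. *)
have rec : \forall n \near \oo,
    r n.+1 * ((E 1 0)%:~R * r n + (E 1 1)%:~R) =
    (E 0 0)%:~R * r n + (E 0 1)%:~R.
  have dS0 : \forall n \near \oo, (tail_mx b1 b2 a n.+1 1 0)%:~R != 0 :> R.
    by case: d0 => N _ HN; exists N => // n /= Nn; apply: HN; rewrite /= leqW.
  near=> n.
  have dn : (tail_mx b1 b2 a n 1 0)%:~R != 0 :> R by near: n.
  have : (tail_mx b1 b2 a n.+1 1 0)%:~R != 0 :> R by near: n.
  rewrite /r tail_mxS -/E 2!(mul2E E) !(rmorphD, rmorphM) /= => dSn.
  by field; rewrite dn.
have lim1 : r n.+1 * ((E 1 0)%:~R * r n + (E 1 1)%:~R) @[n --> \oo] -->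
    x * ((E 1 0)%:~R * x + (E 1 1)%:~R).
  by apply: cvgM => //; apply: cvgD; [apply: cvgMr | apply: cvg_cst].
have lim2 : (E 0 0)%:~R * r n + (E 0 1)%:~R @[n --> \oo] -->
    (E 0 0)%:~R * x + (E 0 1)%:~R.
  by apply: cvgD; [apply: cvgMr | apply: cvg_cst].
have ex : x * ((E 1 0)%:~R * x + (E 1 1)%:~R) =
    (E 0 0)%:~R * x + (E 0 1)%:~R.
  apply: cvg_unique lim2 => //; apply: cvg_trans lim1.
  exact: near_eq_cvg.
have x2 : x ^+ 2 = 2 by rewrite sqr_sqrtr.
(* By [x ^ 2 = 2], the fixed point equation becomes [(E 1 1 - E 0 0) * x = E 0 1 - 2 * E 1 0]. *)
have [] := @sqrt2_lin_eq0 R (E 1 1 - E 0 0) (E 0 1 - 2 * E 1 0).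
  rewrite -/x !(rmorphB, rmorphM) /=.
  have -> : (E 0 1)%:~R = (x * ((E 1 0)%:~R * x + (E 1 1)%:~R)) - (E 0 0)%:~R * x.
    by rewrite ex; ring.
  rewrite mulrDr mulrCA -expr2 x2; ring.
by rewrite /pcf_variety /= -/E => e1 e2; split; lia.
Unshelve. all: by end_near. Qed.

(** * Integer points of the curve *)

Lemma integer_points_sqrt2 (a b x : int) :
  x * (2 * a * b + 1) = 2 * (a * b ^+ 2 - a + b) ->
  (a * b + 1) ^+ 2 - a * (a * b + 1) * x - a ^+ 2 = 2 * (b * x + 1 - b ^+ 2) ->
  (a, b, x) \in [:: (1, 0, -2); (-1, -2, -2); (1, 2, 2); (-1, 0, 2)].
Proof.
(* The equations are invariant under (a, b, x) |-> (- a, - b, - x). *)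
suff pos (a' b' x' : int) : 0 < a' ->
    x' * (2 * a' * b' + 1) = 2 * (a' * b' ^+ 2 - a' + b') ->
    (a' * b' + 1) ^+ 2 - a' * (a' * b' + 1) * x' - a' ^+ 2 = 2 * (b' * x' + 1 - b' ^+ 2) ->
    (a', b', x') \in [:: (1, 0, -2); (1, 2, 2)].
  have [a0|a0|->] := ltgtP a 0 => e1 e2; last nia.
    have := pos (- a) (- b) (- x); rewrite !inE !xpair_eqE.
    move=> /(_ ltac:(lia) ltac:(nia) ltac:(nia)).
    lia.
  have := pos _ _ _ a0 e1 e2; rewrite !inE !xpair_eqE; lia.
move=> {a b x}; move: a' b' x' => a b x a0 e1 e2.
have e3 : (x - b) * (2 * a * b + 1) = b - 2 * a by nia.
rewrite !inE !xpair_eqE.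
have [k0|k0] := eqVneq x b.
  (* With [x = b = 2 * a], the second equation reduces to [a ^ 2 + 1 = 2]. *)
  have eb : b = 2 * a by nia.
  have : a ^+ 2 = 1 by nia.
  have -> : (a ^+ 2 = 1) <-> a = 1 by nia.
  lia.
have [b0|b0|b0] := ltgtP b 0; last first.
(* For [b = 0], [e3] gives [x = - 2 * a], and again [a ^ 2 + 1 = 2]. *)
- have : a ^+ 2 = 1 by nia.
  have -> : (a ^+ 2 = 1) <-> a = 1 by nia.
  nia.
(* For [b > 0], [2 * a * b + 1] exceeds [|b - 2 * a|], against [e3] with [x - b] nonzero. *)
- nia.
(* For [b < 0], [|2 * a * b + 1| <= |b - 2 * a|] amounts to [(2 * a - 1) * (- b - 1) <= 2]. This
   bounds [b], and also [a] unless [b = -1]. *)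
have : b \in [:: -1; -2; -3].
  rewrite !inE; nia.
rewrite !inE => /orP[/eqP|/orP[/eqP|/eqP]] eb; subst b.
(* For [b = -1], [e3] makes [2 * a - 1] a divisor of [2 * a + 1], hence of 2. *)
- have : a <= 2 by nia.
  nia.
- have : a <= 1 by nia.
  nia.
- have : a <= 1 by nia.
  nia.
Qed.

Lemma variety_sqrt2P (y1 y2 x1 : int) :
  pcf_variety 1 0 (-2) [tuple y1; y2] [tuple x1] <->
  (y1, y2, x1) \in [:: (1, 0, -2); (-1, -2, -2); (1, 2, 2); (-1, 0, 2)].
Proof.
rewrite /pcf_variety; have [-> -> -> ->] := Emx21E y1 y2 x1.
split=> [[e1 e2 _]|]; first by apply: integer_points_sqrt2; lia.
by rewrite !inE => /or4P[] /eqP[-> -> ->].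
Qed.

(** * Convergents at the four integer points *)

Lemma tail_mx0 (b1 b2 a : int) :
  tail_mx b1 b2 a 0 0 0 = b1 * b2 + 1 /\ tail_mx b1 b2 a 0 1 0 = b2.
Proof.
by rewrite /tail_mx expr0 mulr1; have [-> _ ->] := Dprod2E b1 b2.
Qed.

(** If the first column [(p, q)] stands for [p + q sqrt 2], the step is multiplication by
    [t + sqrt 2], of norm -1. *)
Lemma tail_mx_sqrt2S (b1 b2 t : int) n :
  (b1, b2, t) \in [:: (1, 0, -1); (-1, -2, -1); (1, 2, 1); (-1, 0, 1)] ->
  let M := tail_mx b1 b2 (2 * t) in
  M n.+1 0 0 = t * M n 0 0 + 2 * M n 1 0 /\
  M n.+1 1 0 = M n 0 0 + t * M n 1 0.
Proof.
move=> bt M; rewrite /M tail_mxS 2!(mul2E (Emx _ _)).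
have [-> -> -> ->] := Emx21E b1 b2 (2 * t).
by move: bt; rewrite !inE => /or4P[] /eqP[-> -> ->]; split; ring.
Qed.

Lemma not_ZPCF_sqrt2 (R : realType) (b1 b2 : int) :
  (b1, b2) \in [:: (1, 0); (-1, -2)] ->
  ~ is_ZPCF_of (Num.sqrt (2 : R))%:C [tuple b1; b2] [tuple (-2 : int)].
Proof.
(* The tolerance sqrt 2 suffices: any number closer than that to sqrt 2 is positive. *)
move=> b12 /is_ZPCF_ofP/(_ (Num.sqrt 2)).
rewrite sqrtr_gt0 ltr0n => /(_ isT)[N _ /(_ N (leqnn N))].
have : tail_mx b1 b2 (-2) N 0 0 * tail_mx b1 b2 (-2) N 1 0 <= 0.
  elim: N => [|n IHn].
    have [-> ->] := tail_mx0 b1 b2 (-2).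
    by move: b12; rewrite !inE => /orP[] /eqP[-> ->].
  have [|-> ->] := @tail_mx_sqrt2S b1 b2 (-1) n.
    by move: b12; rewrite !inE => /orP[] /eqP[-> ->].
  (* The new product is [- p ^ 2 + 3 * p * q - 2 * q ^ 2]. *)
  rewrite mulrN1; move: (tail_mx _ _ _ _ 0 0) (tail_mx _ _ _ _ 1 0) IHn => p q.
  by have := sqr_ge0 p; have := sqr_ge0 q; nia.
move: (tail_mx _ _ _ _ 0 0) (tail_mx _ _ _ _ 1 0) => p q pq [q0].
have : p%:~R / q%:~R <= 0 :> R.
  have pqR : p%:~R * q%:~R <= 0 :> R by rewrite -rmorphM /= lerz0.
  rewrite -(pmulr_lle0 _ (_ : 0 < q%:~R ^+ 2)) ?exprn_even_gt0 //.
  by rewrite expr2 mulrA divfK.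
have := sqrtr_ge0 (2 : R); rewrite ltr_norml; lra.
Qed.

Lemma ZPCF_sqrt2 (R : realType) (b1 b2 : int) :
  (b1, b2) \in [:: (-1, 0); (1, 2)] ->
  is_ZPCF_of (Num.sqrt (2 : R))%:C [tuple b1; b2] [tuple (2 : int)].
Proof.
move=> b12; apply/is_ZPCF_ofP => e e0.
have inv n : [/\ 1 <= tail_mx b1 b2 2 n 0 0, n%:Z <= tail_mx b1 b2 2 n 1 0
   & `|tail_mx b1 b2 2 n 0 0 ^+ 2 - 2 * tail_mx b1 b2 2 n 1 0 ^+ 2| = 1].
  elim: n => [|n [IH1 IH2 IH3]].
    have [-> ->] := tail_mx0 b1 b2 2.
    by move: b12; rewrite !inE => /orP[] /eqP[-> ->].
  have [|-> ->] := @tail_mx_sqrt2S b1 b2 1 n.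
    by move: b12; rewrite !inE => /orP[] /eqP[-> ->].
  rewrite mulr1 !mul1r; split; [lia|lia|].
  (* The norm [p ^ 2 - 2 * q ^ 2] changes sign at each step. *)
  by rewrite -[RHS]IH3 -[RHS]normrN; congr (`|_|); ring.
have x2 : Num.sqrt (2 : R) ^+ 2 = 2 by rewrite sqr_sqrtr.
have x1 : 1 <= Num.sqrt (2 : R).
  by rewrite -(ler_pXn2r (ltn0Sn 1)) ?nnegrE ?sqrtr_ge0 // x2 expr1n ler1n.
near=> n.
have ne : e^-1 < n%:R by near: n; exact: nbhs_infty_gtr.
have [p1 qn pq] := inv n.
move: (tail_mx _ _ _ _ 0 0) (tail_mx _ _ _ _ 1 0) p1 qn pq => p q p1 qn pq.
set x := Num.sqrt 2 in x1 x2 *.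
have qe : e^-1 < q%:~R.
  by apply: lt_le_trans ne _; rewrite -(ler_int R) in qn.
have q0 : 0 < q%:~R :> R by apply: lt_trans qe; rewrite invr_gt0.
split; first by rewrite gt_eqF.
have p0 : 1 <= p%:~R :> R by rewrite -(ler_int R) in p1.
(* The product is [2 * q ^ 2 - p ^ 2]. Since [x * q + p > 1], the error is below [1 / q], hence
   below [e]. *)
have norm1 : `|(x - p%:~R / q%:~R) * (q%:~R * (x * q%:~R + p%:~R))| = 1.
  rewrite [X in `|X|](_ : _ = (2 * q ^+ 2 - p ^+ 2)%:~R).
    by rewrite -intr_norm distrC pq.
  rewrite !rmorphB /= [(2 * _)%:~R]rmorphM !rmorphXn /=.
  rewrite (_ : 2%:~R = x ^+ 2); last by rewrite x2.
  by field; rewrite gt_eqF.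
have s0 : 1 < x * q%:~R + p%:~R by nra.
have qs : 0 < q%:~R * (x * q%:~R + p%:~R) by nra.
rewrite normrM (gtr0_norm qs) in norm1.
have eq1 : 1 < e * q%:~R by rewrite -ltr_pdivrMl // mulr1.
rewrite ltNge; apply/negP => le; nra.
Unshelve. all: by end_near. Qed.

Theorem proposition7p3 (R : realType) :
  (forall y1 y2 x1 : int,
      pcf_variety 1 0 (-2) [tuple y1; y2] [tuple x1] <->
      (y1, y2, x1) \in [:: (1, 0, -2); (-1, -2, -2); (1, 2, 2); (-1, 0, 2)]) /\
  (forall b1 b2 a1 : int,
      is_ZPCF_of (Num.sqrt (2 : R))%:C [tuple b1; b2] [tuple a1] <->
      (b1, b2, a1) \in [:: (-1, 0, 2); (1, 2, 2)]).
Proof.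
split=> [|b1 b2 a]; first exact: variety_sqrt2P.
split=> [cv|].
  have /variety_sqrt2P := ZPCF_sqrt2_variety cv.
  (* The two points with last coordinate -2 lie on the curve but do not give the value sqrt 2. *)
  rewrite !inE => /or4P[] /eqP[e1 e2 e3]; subst b1 b2 a => //.
    by case: (@not_ZPCF_sqrt2 R 1 0).
  by case: (@not_ZPCF_sqrt2 R (-1) (-2)).
by rewrite !inE => /orP[] /eqP[-> -> ->]; exact: ZPCF_sqrt2.
Qed.
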